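(* ($n\times n$ Krawtchouk type polynomials.) In the setting of the context, the matrices $L(j)$ and $(e_0,\Phi_j)=L(j)\operatorname{diag}(w_{nj}^{1/2},\dots,w_{nj+n-1}^{1/2})$ are invertible for $j=0,\dots,N$. Put $\theta_j=(e_0,\Phi_j)\alpha_j^*(e_0,\Phi_j)^{-1}$. Then there is a family of matrix valued polynomials $\Pi_k(x)=\sum_{i=0}^kM_{k,i}x^i$, $k=0,\dots,N$ ($M_{k,i}\in M_n(\mathbb C)$, $M_{k,k}$ invertible, $x\in M_n(\mathbb C)$), such that for all $j,k,\ell\in\{0,\dots,N\}$: (i) (recurrence) $\Pi_k(\theta_j)\theta_j=A_{k+1}^*\Pi_{k+1}(\theta_j)+B_k\Pi_k(\theta_j)+A_k\Pi_{k-1}(\theta_j)$, with $\Pi_{-1}(\theta_j)=0$, $\Pi_0(\theta_j)=I_n$ (the term with $\Pi_{N+1}$ omitted for $k=N$); (ii) (orthogonality) $\sum_{j=0}^N\Pi_k(\theta_j)W(j)\Pi_\ell(\theta_j)^*=\delta_{k,\ell}I_n$, where $W(j)=L(j)D(j)L(j)^*$ and $D(j)=\operatorname{diag}(w_{nj},\dots,w_{nj+n-1})$; (iii) (difference equation) with $\Lambda_k=\operatorname{diag}(\lambda_{nk}^n,\dots,\lambda_{nk+n-1}^n)$, $$\Lambda_k\Pi_k(\theta_j)=\Pi_k(\theta_{j+1})(e_0,\Phi_{j+1})A_{j+1}(e_0,\Phi_j)+\Pi_k(\theta_j)(e_0,\Phi_j)B_j(e_0,\Phi_j)+\Pi_k(\theta_{j-1})(e_0,\Phi_{j-1})A_j^*(e_0,\Phi_j),$$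 where terms with index $j+1=N+1$ or $j-1=-1$ are omitted.
   Context: $A^*$ is the conjugate transpose. Let $n\ge1$, $N\ge0$, $m=nN+n-1$, and let $V$ be a complex inner product space with orthonormal basis $|k\rangle$, $k=0,\dots,m$; the inner product $\langle\cdot,\cdot\rangle$ is linear in the first argument. The $(m+1)$-dimensional representation of $\mathfrak{su}(2)$ on $V$ is $$H|k\rangle=\lambda_k|k\rangle,\ \lambda_k=2k-m;\quad L^+|k\rangle=\rho_k^+|k+1\rangle,\ \rho_k^+=\sqrt{(k+1)(m-k)};\quad L^-|k\rangle=\rho_k^-|k-1\rangle,\ \rho_k^-=\sqrt{k(m+1-k)}.$$ Let $a\in\mathbb R$ with $\sin a\ne0$, and $P=\cos(a)H+\sin(a)(L^++L^-)$. It is taken as known that $P$ has an orthonormal eigenbasis $|\phi_j\rangle$, $P|\phi_j\rangle=\mu_j|\phi_j\rangle$, $\mu_j=2j-m$, $j=0,\dots,m$, on which $H$ acts by $$H|\phi_j\rangle=\sin(a)\rho_j^+|\phi_{j+1}\rangle+\cos(a)\lambda_j|\phi_j\rangle+\sin(a)\rho_j^-|\phi_{j-1}\rangle,$$ and that the transition coefficients are $\langle k|\phi_j\rangle=K_k(j;p,m)h_k^{-1/2}w_j^{1/2}$, where $p=\frac12(1+\cos a)$ and $$K_k(x;p,m)={}_2F_1\!\left(-x,-k;-m;\tfrac1p\right)=\sum_{i=0}^{k}\frac{(-x)_i(-k)_i}{(-m)_i\,i!}p^{-i},\quad w_j=\binom mjp^j(1-p)^{m-j},\quad h_k=\frac{(-1)^kk!}{(-m)_k}\left(\frac{1-p}p\right)^k$$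 (Krawtchouk polynomials, their weight and squared norms; $(x)_i$ is the Pochhammer symbol). $V^n$ is the left $M_n(\mathbb C)$-module with action $A(v_1,\dots,v_n)=(\sum_ka_{1k}v_k,\dots,\sum_ka_{nk}v_k)$ and matrix valued inner product $(v,w)=(\langle v_i,w_j\rangle)_{i,j}\in M_n(\mathbb C)$; operators on $V$ act on $V^n$ componentwise. For $k,j=0,\dots,N$ put $e_k=(|nk\rangle,\dots,|nk+n-1\rangle)$, $\Phi_j=(|\phi_{nj}\rangle,\dots,|\phi_{nj+n-1}\rangle)$, $\alpha_j=\operatorname{diag}(\mu_{nj}^n,\dots,\mu_{nj+n-1}^n)$. The matrices $A_k$ ($1\le k\le N$) and $B_k=B_k^*$ ($0\le k\le N$) in $M_n(\mathbb C)$ are defined by $$P^n\cdot e_k=A_{k+1}^*e_{k+1}+B_ke_k+A_ke_{k-1},\qquad e_{-1}=e_{N+1}=0.$$ The matrix $L(j)\in M_n(\mathbb C)$ is $L(j)_{i,\ell}=h_{i-1}^{-1/2}K_{i-1}(nj+\ell-1;p,nN+n-1)$, $i,\ell=1,\dots,n$.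
   Formalization: In (iii) the last factor (e_0,Φ_j) of each right-hand term is replaced by its inverse, as the printed formula is false; the result is proved for p=(1±cos a)/2 and for positive or alternating-sign square roots of w_j, h_k, since the printed p is inconsistent with μ_j for most a. *)

(* Defs.v *)
From HB Require Import structures.
From mathcomp Require Import all_boot all_order all_algebra.
From mathcomp Require Import all_classical all_reals all_analysis.
From mathcomp Require Import complex.

Set Implicit Arguments.
Unset Strict Implicit.
Unset Printing Implicit Defensive.

Import Order.TTheory GRing.Theory Num.Theory.
Local Open Scope ring_scope.
Local Open Scope complex_scope.

Notation "A ^H" := (map_mx Num.conj (trmx A))
  (at level 8, format "A ^H") : ring_scope.

(* Basis vectors are families indexed by nat of which only the indices 0..m
   matter; the values at larger indices are irrelevant. *)

Section Su2.
Variables (R : realType) (m : nat).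

Definition lam (k : nat) : R := 2 * k%:R - m%:R.
Definition mu (j : nat) : R := 2 * j%:R - m%:R.
Definition rho_up (k : nat) : R := Num.sqrt (k.+1%:R * (m%:R - k%:R)).
Definition rho_dn (k : nat) : R := Num.sqrt (k%:R * (m%:R + 1 - k%:R)).

Variable V : lmodType R[i].

Definition orthonormal_basis (ip : {dot V for Num.conj}) (b : nat -> V) :=
  (forall k l, (k <= m)%N -> (l <= m)%N -> ip (b k) (b l) = (k == l)%:R) /\
  (forall v : V, exists c : nat -> R[i], v = \sum_(k < m.+1) c k *: b k).

(* At the ends, rho_up m = 0 and rho_dn 0 = 0 annihilate the out-of-range
   vector ket m.+1 and the junk vector ket 0.-1. *)
Definition su2_representation (ket : nat -> V) (H Lp Lm : V -> V) :=
  forall k, (k <= m)%N ->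
    [/\ H (ket k) = (lam k)%:C *: ket k,
        Lp (ket k) = (rho_up k)%:C *: ket k.+1 &
        Lm (ket k) = (rho_dn k)%:C *: ket k.-1].

Definition Pop (a : R) (H Lp Lm : V -> V) (v : V) : V :=
  (cos a)%:C *: H v + (sin a)%:C *: (Lp v + Lm v).

Definition H_tridiagonal (a : R) (H : V -> V) (phi : nat -> V) :=
  forall j, (j <= m)%N ->
    H (phi j) = (sin a * rho_up j)%:C *: phi j.+1 + (cos a * lam j)%:C *: phi j
                + (sin a * rho_dn j)%:C *: phi j.-1.

End Su2.

Section Krawtchouk.
Variable R : realType.

Definition poch (x : R) (i : nat) : R := \prod_(l < i) (x + l%:R).

Definition krawtchouk (k : nat) (x p : R) (m : nat) : R :=
  \sum_(i < k.+1)
    poch (- x) i * poch (- k%:R) i / (poch (- m%:R) i * i`!%:R) * p ^- i.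

Definition kweight (p : R) (m j : nat) : R :=
  'C(m, j)%:R * p ^+ j * (1 - p) ^+ (m - j).

Definition knorm (p : R) (m k : nat) : R :=
  (-1) ^+ k * k`!%:R / poch (- m%:R) k * ((1 - p) / p) ^+ k.

(* The two signs s and t record the conventions on which the form of the
   transition coefficients depends:
   - p = (1 + cos a) / 2 for s = false, p = (1 - cos a) / 2 for s = true;
   - t selects the square roots of w_j and h_k: positive for t = false, with
     alternating signs (-1)^j and (-1)^k for t = true.
   Comparing means, <0|P|0> = - m cos a with \sum_j w_j mu_j = m (2 p - 1),
   shows that for mu_j = 2 j - m and m > 0 the coefficients require
   p = (1 - cos a) / 2; then t is the truth value of sin a > 0. *)
Definition kpar (s : bool) (a : R) : R := (1 + (-1) ^+ s * cos a) / 2.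

Definition sqrt_kweight (t : bool) (p : R) (m j : nat) : R :=
  (-1) ^+ (t * j) * Num.sqrt (kweight p m j).

Definition sqrt_knorm (t : bool) (p : R) (m k : nat) : R :=
  (-1) ^+ (t * k) * Num.sqrt (knorm p m k).

Definition transition_coef (t : bool) (p : R) (m k j : nat) : R :=
  krawtchouk k j%:R p m / sqrt_knorm t p m k * sqrt_kweight t p m j.

End Krawtchouk.

Section MatrixValued.
Variables (R : realType) (n : nat) (V : lmodType R[i]).

Definition mxact (A : 'M[R[i]]_n) (v : {ffun 'I_n -> V}) : {ffun 'I_n -> V} :=
  [ffun i => \sum_(k < n) A i k *: v k].

Definition mxip (ip : {dot V for Num.conj}) (v w : {ffun 'I_n -> V})
  : 'M[R[i]]_n := \matrix_(i, j) ip (v i) (w j).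

Definition opact (T : V -> V) (v : {ffun 'I_n -> V}) : {ffun 'I_n -> V} :=
  [ffun i => T (v i)].

(* The k-th block (b_{nk}, ..., b_{nk+n-1}). *)
Definition block (b : nat -> V) (k : nat) : {ffun 'I_n -> V} :=
  [ffun i : 'I_n => b (n * k + i)%N].

End MatrixValued.

Section BlockMatrices.
Variables (R : realType) (n : nat).

(* diag(f_{nj}, ..., f_{nj+n-1}) *)
Definition block_diag (f : nat -> R) (j : nat) : 'M[R[i]]_n :=
  diag_mx (\row_(i < n) (f (n * j + i)%N)%:C).

(* Row and column indices start at 0. *)
Definition Lmx (t : bool) (p : R) (m j : nat) : 'M[R[i]]_n :=
  \matrix_(i < n, l < n)
    (krawtchouk i (n * j + l)%:R p m / sqrt_knorm t p m i)%:C.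

Definition Wmx (t : bool) (p : R) (m j : nat) : 'M[R[i]]_n :=
  Lmx t p m j *m block_diag (kweight p m) j *m (Lmx t p m j)^H.

Definition mxpoly_eval (M : nat -> nat -> 'M[R[i]]_n) (k : nat)
    (x : 'M[R[i]]_n) : 'M[R[i]]_n :=
  \sum_(i < k.+1) M k i *m x ^+ i.

End BlockMatrices.

(* Main.v *)
Require Import Defs.
From HB Require Import structures.
From mathcomp Require Import all_boot all_order all_algebra.
From mathcomp Require Import all_classical all_reals all_analysis.
From mathcomp Require Import complex.
From mathcomp Require Import zify lra.

Set Implicit Arguments.
Unset Strict Implicit.
Unset Printing Implicit Defensive.

Import Order.TTheory GRing.Theory Num.Theory.
Local Open Scope ring_scope.
Local Open Scope complex_scope.

(* The coefficients F_k(j) = (e_k, Phi_j) are the eigenvectors of P^n in block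
   form: expanding (P^n e_k, Phi_j) in two ways gives
     F_k alpha_j = A_{k+1}^* F_{k+1} + B_k F_k + A_k F_{k-1}.
   The recurrence can be solved for F_{k+1}, since A_{k+1}^* is a block of the
   banded matrix of P^n, triangular with products of the off-diagonal entries
   sin(a) rho^+ of P on its diagonal. As theta_j = F_0 alpha_j F_0^{-1}, the
   polynomials Pi_k generated by it satisfy Pi_k(theta_j) = F_k(j) F_0(j)^{-1}.
   Orthogonality is then Parseval's identity in the basis phi.
   H acts on phi as P acts on the basis ket, so H^n Phi_j obeys the block
   recurrence with the same A and B; taking the product with e_k, on which H^n is
   diagonal, yields the difference equation. *)

(** * Coordinates in an orthonormal basis *)

Lemma conj_real_complex (R : realType) (x : R) : Num.conj x%:C = x%:C.
Proof. exact: conjc_real. Qed.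

Lemma sum_delta_scale (K : nzRingType) (V : lmodType K) (b : nat -> V) m k :
  (k <= m)%N -> \sum_(l < m.+1) (k == l)%:R *: b l = b k.
Proof.
move=> lekm; rewrite (bigD1 (inord k)) //= inordK ?ltnS // eqxx scale1r.
rewrite big1 ?addr0 // => l lk; rewrite (_ : (k == l :> nat) = false) ?scale0r //.
by apply: contraNF lk => /eqP ->; rewrite inord_val.
Qed.

Section OrthonormalBasis.
Variables (R : realType) (m : nat) (V : lmodType R[i]).
Variables (ip : {dot V for Num.conj}) (b : nat -> V).

Lemma dot_conj u v : ip u v = Num.conj (ip v u).
Proof. by rewrite hermC expr0 mul1r. Qed.

Lemma dotZl c u v : ip (c *: u) v = c * ip u v.
Proof. exact: linearZl_LR. Qed.

Lemma dotZr c u v : ip u (c *: v) = Num.conj c * ip u v.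
Proof. exact: linearZr_LR. Qed.

Lemma dotDl u v w : ip (u + v) w = ip u w + ip v w.
Proof. exact: linearDl. Qed.

Lemma dotDr u v w : ip u (v + w) = ip u v + ip u w.
Proof. exact: linearDr. Qed.

Lemma dot0l v : ip 0 v = 0.
Proof. exact: linear0l. Qed.

Lemma dot0r v : ip v 0 = 0.
Proof. exact: linear0r. Qed.

Lemma dot_suml I (r : seq I) (Q : pred I) (F : I -> V) v :
  ip (\sum_(i <- r | Q i) F i) v = \sum_(i <- r | Q i) ip (F i) v.
Proof. exact: linear_sumlz. Qed.

Lemma dot_sumr I (r : seq I) (Q : pred I) (F : I -> V) v :
  ip v (\sum_(i <- r | Q i) F i) = \sum_(i <- r | Q i) ip v (F i).
Proof. exact: linear_sumr. Qed.

Hypothesis onb : orthonormal_basis m ip b.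

Lemma dot_suml_onb (c : nat -> R[i]) k : (k <= m)%N ->
  ip (\sum_(l < m.+1) c l *: b l) (b k) = c k.
Proof.
move=> lekm; rewrite dot_suml (bigD1 (inord k)) //= inordK ?ltnS //.
rewrite dotZl onb.1 // eqxx mulr1 big1 ?addr0 // => l lk.
have lelm : (l <= m)%N by rewrite -ltnS.
rewrite dotZl onb.1 // (_ : (l == k :> nat) = false) ?mulr0 //.
by apply: contraNF lk => /eqP <-; rewrite inord_val.
Qed.

Lemma onb_expand v : v = \sum_(k < m.+1) ip v (b k) *: b k.
Proof.
have [c def_v] := onb.2 v; rewrite {1}def_v; apply: eq_bigr => k _.
by rewrite def_v dot_suml_onb // -ltnS.
Qed.

Lemma onb_parseval u v :
  ip u v = \sum_(k < m.+1) ip u (b k) * Num.conj (ip v (b k)).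
Proof.
rewrite [in LHS](onb_expand u) dot_suml; apply: eq_bigr => k _.
by rewrite dotZl (dot_conj (b k)).
Qed.

(** In the expansion of v in the basis b, each application of T multiplies the k-th coordinate by
    x_k. *)
Lemma dot_iter_eigen (T : {linear V -> V}) (x : nat -> R) r v k :
  (forall j, (j <= m)%N -> T (b j) = (x j)%:C *: b j) -> (k <= m)%N ->
  ip (iter r T v) (b k) = (x k ^+ r)%:C * ip v (b k).
Proof.
move=> Tb lekm; elim: r v => [|r IHr] v; first by rewrite mul1r.
rewrite iterSr IHr exprSr rmorphM -mulrA; congr (_ * _).
rewrite [in LHS](onb_expand v) linear_sum.
have Tbj (j : 'I_m.+1) : T (ip v (b j) *: b j) = (ip v (b j) * (x j)%:C) *: b j.
  by rewrite linearZ_LR /= Tb ?scalerA // -ltnS.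
rewrite (eq_bigr _ (fun j _ => Tbj j)).
by rewrite (dot_suml_onb (fun j => ip v (b j) * (x j)%:C)) // mulrC.
Qed.

End OrthonormalBasis.

(** * Powers of a tridiagonal operator *)

Section Tridiagonal.
Variables (R : realType) (u d w : nat -> R[i]).

(* The coefficient of b_l in T^r b_k, for an operator T acting by
   T b_k = u_k b_{k+1} + d_k b_k + w_k b_{k-1}. *)
Fixpoint tridiag_coef (r k l : nat) : R[i] :=
  if r is r'.+1 then
    u k * tridiag_coef r' k.+1 l + d k * tridiag_coef r' k l
    + w k * tridiag_coef r' k.-1 l
  else (k == l)%:R.

(** One application of T raises the index by at most one. *)
Lemma tridiag_coef_gt r k l : (k + r < l)%N -> tridiag_coef r k l = 0.
Proof.
elim: r k => [|r IHr] k /= ltkl.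
  by rewrite ltn_eqF // -(addn0 k).
by rewrite !IHr ?mulr0 ?addr0 //; lia.
Qed.

(** Only the path of r consecutive upward steps leads from k to k + r. *)
Lemma tridiag_coef_top r k :
  tridiag_coef r k (k + r)%N = \prod_(i < r) u (k + i)%N.
Proof.
elim: r k => [|r IHr] k; first by rewrite addn0 /= eqxx big_ord0.
rewrite /= (@tridiag_coef_gt r k) ?(@tridiag_coef_gt r k.-1) ?mulr0 ?addr0; try lia.
rewrite -addSnnS IHr big_ord_recl addn0; congr (_ * _).
by apply: eq_bigr => i _; rewrite lift0 addSnnS.
Qed.

Lemma iter_tridiag (V : lmodType R[i]) (T : {linear V -> V}) (b : nat -> V) m r k :
  (forall j, (j <= m)%N ->
     T (b j) = u j *: b j.+1 + d j *: b j + w j *: b j.-1) ->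
  u m = 0 -> (k <= m)%N ->
  iter r T (b k) = \sum_(l < m.+1) tridiag_coef r k l *: b l.
Proof.
move=> Tb um0; elim: r k => [|r IHr] k lekm; first by rewrite sum_delta_scale.
(* The recursion of [tridiag_coef] applies T to b_k first, so the remaining iterate has to be
   distributed over a sum. *)
have iter_lin c x y : iter r T (c *: x + y) = c *: iter r T x + iter r T y.
  by elim: r {IHr} => //= r ->; rewrite linearP.
have iterZ c x : iter r T (c *: x) = c *: iter r T x.
  have it0 : iter r T 0 = 0 by elim: r {IHr iter_lin} => //= r ->; rewrite linear0.
  by rewrite -[c *: x]addr0 iter_lin it0 addr0.
rewrite iterSr Tb // -addrA !iter_lin iterZ.
rewrite (IHr k) // (IHr k.-1); last exact: leq_trans (leq_pred _) _.
have -> : u k *: iter r T (b k.+1)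
    = \sum_(l < m.+1) (u k * tridiag_coef r k.+1 l) *: b l.
  (* For k = m the vector b_{m+1} is arbitrary, but its coefficient u_m vanishes. At the other end,
     [Tb] and [tridiag_coef] both read the predecessor of 0 as 0. *)
  have [ltkm|] := ltnP k m.
    by rewrite IHr // scaler_sumr; apply: eq_bigr => l _; rewrite scalerA.
  move=> lemk; have -> : k = m by apply/eqP; rewrite eqn_leq lekm.
  by rewrite um0 scale0r big1 // => l _; rewrite mul0r scale0r.
rewrite !scaler_sumr -!big_split; apply: eq_bigr => l _ /=.
by rewrite !scalerA !scalerDl addrA.
Qed.

End Tridiagonal.

(** * Splitting the indices 0..m into N + 1 blocks of length n *)

Section BlockIndices.
Variables (n N : nat).
Hypothesis n_gt0 : (0 < n)%N.
Let m := (n * N + n - 1)%N.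

Lemma block_index_le k (i : 'I_n) : (k <= N)%N -> (n * k + i <= m)%N.
Proof. by move=> lekN; have := ltn_ord i; rewrite /m; nia. Qed.

Lemma block_index_eq (k l : nat) (i j : 'I_n) :
  (n * k + i == n * l + j)%N = (k == l) && (i == j).
Proof.
rewrite !(mulnC n); apply/eqP/andP => [eq_idx|[/eqP-> /eqP->]//].
have := congr1 (divn^~ n) eq_idx; have := congr1 (modn^~ n) eq_idx.
rewrite !modnMDl !divnMDl // !modn_small // !divn_small // !addn0.
by move=> /val_inj-> ->.
Qed.

Lemma big_block (W : nmodType) (f : nat -> W) :
  \sum_(k < m.+1) f k = \sum_(k < N.+1) \sum_(i < n) f (n * k + i)%N.
Proof.
(* Since n > 0, the truncated subtraction in m is exact. *)
have -> : m.+1 = (N.+1 * n)%N by rewrite /m; nia.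
rewrite -(big_mkord xpredT) big_nat_mul big_mkord; apply: eq_bigr => k _.
rewrite -{1}[(k * n)%N]add0n mulSn big_addn addnK big_mkord.
by apply: eq_bigr => i _; rewrite addnC mulnC.
Qed.

End BlockIndices.

(** * The matrix valued inner product on blocks *)

Section MatrixInnerProduct.
Variables (R : realType) (n : nat) (V : lmodType R[i]).
Variables (ip : {dot V for Num.conj}).
Implicit Types (v w : {ffun 'I_n -> V}) (A : 'M[R[i]]_n).

Lemma mxipDl v1 v2 w : mxip ip (v1 + v2) w = mxip ip v1 w + mxip ip v2 w.
Proof. by apply/matrixP => i j; rewrite !mxE ffunE dotDl. Qed.

Lemma mxipDr v w1 w2 : mxip ip v (w1 + w2) = mxip ip v w1 + mxip ip v w2.
Proof. by apply/matrixP => i j; rewrite !mxE ffunE dotDr. Qed.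

Lemma mxip0l w : mxip ip 0 w = 0.
Proof. by apply/matrixP => i j; rewrite !mxE ffunE dot0l. Qed.

Lemma mxip0r v : mxip ip v 0 = 0.
Proof. by apply/matrixP => i j; rewrite !mxE ffunE dot0r. Qed.

Lemma mxip_actl A v w : mxip ip (mxact A v) w = A *m mxip ip v w.
Proof.
apply/matrixP => i j; rewrite !mxE ffunE dot_suml.
by apply: eq_bigr => k _; rewrite dotZl mxE.
Qed.

Lemma mxip_actr A v w : mxip ip v (mxact A w) = mxip ip v w *m A^H.
Proof.
apply/matrixP => i j; rewrite !mxE ffunE dot_sumr.
by apply: eq_bigr => k _; rewrite dotZr !mxE mulrC.
Qed.

Lemma opact_mxact (U : {linear V -> V}) A v :
  opact U (mxact A v) = mxact A (opact U v).
Proof.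
apply/ffunP => i; rewrite !ffunE linear_sum; apply: eq_bigr => k _.
by rewrite linearZ_LR ffunE.
Qed.

Lemma opactD (U : {linear V -> V}) v w : opact U (v + w) = opact U v + opact U w.
Proof. by apply/ffunP => i; rewrite !ffunE linearD. Qed.

Lemma opact0 (U : {linear V -> V}) : opact U (0 : {ffun 'I_n -> V}) = 0.
Proof. by apply/ffunP => i; rewrite !ffunE linear0. Qed.

Variables (N : nat).
Hypothesis n_gt0 : (0 < n)%N.
Let m := (n * N + n - 1)%N.

Lemma mxip_block_onb (b : nat -> V) k l : orthonormal_basis m ip b ->
  (k <= N)%N -> (l <= N)%N ->
  mxip ip (block n b k) (block n b l) = (k == l)%:R%:M.
Proof.
move=> onb lek lel; apply/matrixP => i j.
rewrite !mxE !ffunE onb.1 ?block_index_le // block_index_eq // -mulrnA mulnb.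
by rewrite (eq_sym i).
Qed.

(** Parseval's identity entry by entry: grouping the m + 1 terms into blocks turns each inner sum
    into an entry of a matrix product. *)
Lemma mxip_block_parseval (b c d : nat -> V) k l : orthonormal_basis m ip b ->
  mxip ip (block n c k) (block n d l) =
  \sum_(j < N.+1) mxip ip (block n c k) (block n b j)
                    *m (mxip ip (block n d l) (block n b j))^H.
Proof.
move=> onb; apply/matrixP => i j; rewrite mxE !ffunE (onb_parseval onb).
pose f r := ip (c (n * k + i)%N) (b r) * Num.conj (ip (d (n * l + j)%N) (b r)).
rewrite (big_block N n_gt0 f) summxE; apply: eq_bigr => r _.
by rewrite mxE; apply: eq_bigr => q _; rewrite !mxE !ffunE.
Qed.

Lemma mxip_block_eigenr (b c : nat -> V) (T : {linear V -> V}) (x : nat -> R) r k j :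
  orthonormal_basis m ip b ->
  (forall l, (l <= m)%N -> T (b l) = (x l)%:C *: b l) -> (j <= N)%N ->
  mxip ip (opact (iter r T) (block n c k)) (block n b j)
  = mxip ip (block n c k) (block n b j) *m block_diag n (fun l => x l ^+ r) j.
Proof.
move=> onb Tb leN; apply/matrixP => i l.
rewrite mul_mx_diag !mxE !ffunE (dot_iter_eigen onb r _ Tb) ?block_index_le //.
by rewrite mulrC.
Qed.

Lemma mxipC v w : mxip ip w v = (mxip ip v w)^H.
Proof. by apply/matrixP => i j; rewrite !mxE -dot_conj. Qed.

Lemma block_diag_conj (f : nat -> R) j : (block_diag n f j)^H = block_diag n f j.
Proof.
rewrite tr_diag_mx; apply/matrixP => i l.
by rewrite !mxE rmorphMn /= conj_real_complex.
Qed.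

Lemma adjmxM (A B : 'M[R[i]]_n) : (A *m B)^H = B^H *m A^H.
Proof. by rewrite trmx_mul map_mxM. Qed.

Lemma adjmxK (A : 'M[R[i]]_n) : (A^H)^H = A.
Proof. by apply/matrixP => i j; rewrite !mxE conjCK. Qed.

Lemma adjmx_inv (A : 'M[R[i]]_n) : (invmx A)^H = invmx A^H.
Proof. by rewrite trmx_inv map_invmx. Qed.

Lemma unitmx_adj (A : 'M[R[i]]_n) : (A^H \in unitmx) = (A \in unitmx).
Proof. by rewrite map_unitmx unitmx_tr. Qed.

(** The adjoint of [mxip_block_eigenr]; the diagonal factor is self-adjoint because the eigenvalues
    are real. *)
Lemma mxip_block_eigenl (b c : nat -> V) (T : {linear V -> V}) (x : nat -> R) r k j :
  orthonormal_basis m ip b ->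
  (forall l, (l <= m)%N -> T (b l) = (x l)%:C *: b l) -> (k <= N)%N ->
  mxip ip (block n b k) (opact (iter r T) (block n c j))
  = block_diag n (fun l => x l ^+ r) k *m mxip ip (block n b k) (block n c j).
Proof.
move=> onb Tb lekN.
by rewrite mxipC (mxip_block_eigenr _ _ _ onb Tb) // adjmxM -mxipC block_diag_conj.
Qed.

End MatrixInnerProduct.

(** * Matrix polynomials generated by a three-term recurrence *)

Section MatrixPolynomials.
Variables (R : realType) (n : nat) (A B : nat -> 'M[R[i]]_n).

(* The coefficient of x^i in the polynomial Pi_k obtained by solving the
   three-term recurrence Pi_k x = A_{k+1}^* Pi_{k+1} + B_k Pi_k + A_k Pi_{k-1}. *)
Fixpoint recurrence_coef (k i : nat) : 'M[R[i]]_n :=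
  if k is k'.+1 then
    invmx (A k'.+1)^H *m
      ((if i is i'.+1 then recurrence_coef k' i' else 0)
       - B k' *m recurrence_coef k' i
       - (if k' is k''.+1 then A k' *m recurrence_coef k'' i else 0))
  else (i == 0)%:R%:M.

Lemma recurrence_coefS k i :
  recurrence_coef k.+1 i.+1 = invmx (A k.+1)^H *m
    (recurrence_coef k i - B k *m recurrence_coef k i.+1
     - (if k is l.+1 then A k *m recurrence_coef l i.+1 else 0)).
Proof. by []. Qed.

Lemma recurrence_coef_gt k i : (k < i)%N -> recurrence_coef k i = 0.
Proof.
(* The recurrence has depth two, so the induction carries two consecutive degrees. *)
suff H : (forall i, (k < i)%N -> recurrence_coef k i = 0) /\
         (forall i, (k.+1 < i)%N -> recurrence_coef k.+1 i = 0) by apply: H.1.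
elim: k {i} => [|k [IH1 IH2]].
  split=> [[|i] // _|[|[|i]] // _] /=; first by rewrite raddf0.
  by rewrite !(raddf0, mulmx0, subr0).
split=> // -[|i] // ltki.
rewrite recurrence_coefS !IH2 ?IH1; try lia.
by rewrite !mulmx0 !subr0 mulmx0.
Qed.

(** Coefficients stand to the left of the powers of x, so right multiplication by x only shifts
    degrees, although x need not commute with them. *)
Lemma mxpoly_eval_recurrence k (x : 'M[R[i]]_n) : (A k.+1 \in unitmx) ->
  let Pi l := mxpoly_eval recurrence_coef l x in
  Pi k *m x = (A k.+1)^H *m Pi k.+1 + B k *m Pi k
              + (if (0 < k)%N then A k *m Pi k.-1 else 0).
Proof.
move=> uA Pi.
(* All sums are padded with zero coefficients to the length k + 2, so that they can be compared term
   by term. *)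
have PiE l : (l <= k.+1)%N -> Pi l = \sum_(i < k.+2) recurrence_coef l i *m x ^+ i.
  move=> lel; rewrite /Pi /mxpoly_eval.
  rewrite (big_ord_widen k.+2 (fun i => recurrence_coef l i *m x ^+ i)) //.
  rewrite [RHS](bigID (fun i : 'I__ => (i < l.+1)%N)) /= [X in _ + X]big1 ?addr0 //.
  by move=> i; rewrite -leqNgt => lti; rewrite recurrence_coef_gt // mul0mx.
have Pix : Pi k *m x = \sum_(i < k.+2)
   (if val i is i'.+1 then recurrence_coef k i' else 0) *m x ^+ i.
  rewrite big_ord_recl mul0mx add0r mulmx_suml; apply: eq_bigr => i _.
  by rewrite lift0 /= -mulmxA exprSr.
have -> : (if (0 < k)%N then A k *m Pi k.-1 else 0) = \sum_(i < k.+2)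
   (if k is k'.+1 then A k *m recurrence_coef k' i else 0) *m x ^+ i.
  case: k {uA Pix} @Pi PiE => [|k] Pi PiE /=.
    by rewrite big1 // => i _; rewrite mul0mx.
  by rewrite PiE ?mulmx_sumr; [apply: eq_bigr => i _; rewrite mulmxA|lia].
rewrite Pix !PiE // !mulmx_sumr -!big_split; apply: eq_bigr => i _ /=.
rewrite !mulmxA -!mulmxDl; congr (_ *m _).
by rewrite mulmxV ?unitmx_adj // mul1mx addrAC subrK subrK.
Qed.

(** The leading coefficient is the product of the inverses of A_k^*, ..., A_1^*. *)
Lemma recurrence_coef_unit k : (forall l, (0 < l <= k)%N -> A l \in unitmx) ->
  recurrence_coef k k \in unitmx.
Proof.
elim: k => [|k IHk] uA; first exact: unitmx1.
have -> : recurrence_coef k.+1 k.+1 = invmx (A k.+1)^H *m recurrence_coef k k.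
  rewrite recurrence_coefS (@recurrence_coef_gt k k.+1) // mulmx0 subr0.
  by case: (k) => [|l]; rewrite ?subr0 // (@recurrence_coef_gt l l.+2) // mulmx0 subr0.
rewrite unitmx_mul unitmx_inv unitmx_adj uA ?leqnn //=.
by apply: IHk => l /andP[l0 lel]; rewrite uA // l0 leqW.
Qed.

End MatrixPolynomials.

(** * Positivity of the weight and linearity of P *)

(** As sin a is nonzero, |cos a| < 1, and p lies strictly between 0 and 1 for either sign s. *)
Lemma kweight_gt0 (R : realType) (s : bool) (a : R) m j :
  sin a != 0 -> (j <= m)%N -> 0 < kweight (kpar s a) m j.
Proof.
move=> sina lejm; have sin2 : 0 < sin a ^+ 2 by rewrite lt_def sqrf_eq0 sina sqr_ge0.
have cs := cos2Dsin2 a.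
have cos_lt1 : -1 < cos a < 1.
  by rewrite -ltr_norml -(@ltr_pXn2r _ 2) ?nnegrE // real_normK ?num_real // expr1n; lra.
rewrite /kweight /kpar; set q := _ / 2.
have q01 : 0 < q < 1 by rewrite /q; case: s {q}; rewrite ?expr1 ?expr0; lra.
rewrite !mulr_gt0 ?exprn_gt0 ?ltr0n ?bin_gt0 //; lra.
Qed.

Lemma sqrt_kweightM (R : realType) t (p : R) m j :
  0 <= kweight p m j -> sqrt_kweight t p m j * sqrt_kweight t p m j = kweight p m j.
Proof.
move=> w_ge0; rewrite /sqrt_kweight mulrACA -expr2 -expr2 sqr_sqrtr // -exprM mulnC.
by rewrite exprM sqrrN expr1n expr1n mul1r.
Qed.

Lemma Pop_linear (R : realType) (V : lmodType R[i]) (a : R) (H Lp Lm : {linear V -> V}) :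
  linear (Pop a H Lp Lm).
Proof.
move=> c u v; have ZC x y (z : V) : x *: (y *: z) = y *: (x *: z).
  by rewrite !scalerA mulrC.
rewrite /Pop (linearP H) (linearP Lp) (linearP Lm) [X in _ + _ *: X]addrACA -scalerDr.
rewrite (scalerDr (cos a)%:C) (scalerDr (sin a)%:C) addrACA [in RHS]scalerDr.
by rewrite (ZC (cos a)%:C) (ZC (sin a)%:C).
Qed.

HB.instance Definition _ (R : realType) (V : lmodType R[i]) (a : R)
  (H Lp Lm : {linear V -> V}) :=
  GRing.isLinear.Build R[i] V V *:%R (Pop a H Lp Lm) (Pop_linear a H Lp Lm).

(** * Invertible blocks and transfer between bases *)

Section BandOperators.
Variables (R : realType) (n N : nat) (V : lmodType R[i]).
Variables (ip : {dot V for Num.conj}) (u d w : nat -> R[i]).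
Hypothesis n_gt0 : (0 < n)%N.
Let m := (n * N + n - 1)%N.
Hypotheses (u_neq0 : forall k, (k < m)%N -> u k != 0) (um0 : u m = 0).
Variables (b : nat -> V) (T : {linear V -> V}).
Hypothesis onb : orthonormal_basis m ip b.
Hypothesis Tb : forall k, (k <= m)%N ->
  T (b k) = u k *: b k.+1 + d k *: b k + w k *: b k.-1.

Lemma dot_iter_tridiag r k l : (k <= m)%N -> (l <= m)%N ->
  ip (iter r T (b k)) (b l) = tridiag_coef u d w r k l.
Proof. by move=> lekm lelm; rewrite (iter_tridiag r Tb) // dot_suml_onb. Qed.

(* The matrix of T^n is banded with bandwidth n, so that its block above the
   diagonal is triangular. *)
Lemma upper_block_unit k : (k < N)%N ->
  mxip ip (opact (iter n T) (block n b k)) (block n b k.+1) \in unitmx.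
Proof.
move=> ltkN; set X := mxip _ _ _.
have XE i l : X i l = tridiag_coef u d w n (n * k + i)%N (n * k.+1 + l)%N.
  by rewrite mxE !ffunE dot_iter_tridiag ?(block_index_le n_gt0) // ltnW.
rewrite unitmxE det_trig ?unitfE; last first.
  apply/is_trig_mxP => i l ltil; rewrite XE tridiag_coef_gt //; lia.
apply/prodf_neq0 => i _.
have -> : X i i = tridiag_coef u d w n (n * k + i)%N (n * k + i + n)%N.
  by rewrite XE; congr tridiag_coef; lia.
rewrite tridiag_coef_top; apply/prodf_neq0 => l _; apply: u_neq0.
(* With k < N and i, l < n, the index nk + i + l is at most m - 1, so the vanishing u_m is not
   met. *)
have := ltn_ord i; have := ltn_ord l; rewrite /m; nia.
Qed.

(* T^i b_0, i < n, are triangular combinations of b_0, ..., b_{n-1}, and their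
   products with eigenvectors form a Vandermonde matrix. *)
Lemma eigenvector_block_unit (x : 'I_n -> R) (y : {ffun 'I_n -> V}) :
  injective x -> (forall l, ip (b 0) (y l) != 0) ->
  (forall r v l, ip (iter r T v) (y l) = (x l ^+ r)%:C * ip v (y l)) ->
  mxip ip (block n b 0) y \in unitmx.
Proof.
move=> x_inj b0y Ty.
pose K : 'M[R[i]]_n := \matrix_(i, k) tridiag_coef u d w i 0 k.
have KE : K *m mxip ip (block n b 0) y =
    Vandermonde n (\row_l (x l)%:C) *m diag_mx (\row_l ip (b 0) (y l)).
  apply/matrixP => i l; rewrite mul_mx_diag !mxE -rmorphXn /= -Ty.
  rewrite (iter_tridiag i Tb) // dot_suml.
  have lenm : (n <= m.+1)%N by rewrite /m; nia.
  rewrite [RHS](bigID (fun k : 'I__ => (k < n)%N)) /= [X in _ = _ + X]big1 ?addr0; last first.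
    move=> k; rewrite -leqNgt => lenk.
    by rewrite tridiag_coef_gt ?scale0r ?dot0l ?add0n ?(leq_trans _ lenk).
  rewrite -(big_ord_widen _ (fun k => ip (tridiag_coef u d w i 0 k *: b k) (y l))) //.
  by apply: eq_bigr => k _; rewrite !mxE dotZl !ffunE muln0.
(* A factor of an invertible product of square matrices is invertible, so det K need not be
   computed. *)
suff : K *m mxip ip (block n b 0) y \in unitmx by rewrite unitmx_mul => /andP[].
rewrite KE unitmxE det_mulmx det_Vandermonde det_diag unitfE mulf_neq0 //.
  apply/prodf_neq0 => i _; apply/prodf_neq0 => l ltil.
  rewrite !mxE subr_eq0; apply: contraTneq ltil => /complexI/x_inj->.
  by rewrite ltnn.
by apply/prodf_neq0 => l _; rewrite mxE.
Qed.

Variables (c : nat -> V) (S : {linear V -> V}).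
Hypothesis Sc : forall k, (k <= m)%N ->
  S (c k) = u k *: c k.+1 + d k *: c k + w k *: c k.-1.

(** The map with b_k -> c_k. As T on b and S on c have the same tridiagonal coefficients, it carries
    T^r b_k to S^r c_k; it is applied to P on [ket] and H on [phi]. *)
Definition basis_change (v : V) : V := \sum_(k < m.+1) ip v (b k) *: c k.

Lemma basis_change_linear : linear basis_change.
Proof.
move=> z v1 v2; rewrite /basis_change scaler_sumr -big_split; apply: eq_bigr => k _ /=.
by rewrite dotDl dotZl scalerDl scalerA.
Qed.

HB.instance Definition _ :=
  GRing.isLinear.Build R[i] V V *:%R basis_change basis_change_linear.

Lemma basis_changeE k : (k <= m)%N -> basis_change (b k) = c k.
Proof.
move=> lekm; rewrite -[RHS](sum_delta_scale c lekm); apply: eq_bigr => l _.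
by rewrite onb.1 // -ltnS.
Qed.

Lemma basis_change_iter r k : (k <= m)%N ->
  basis_change (iter r T (b k)) = iter r S (c k).
Proof.
move=> lekm; rewrite (iter_tridiag r Sc) //; apply: eq_bigr => l _.
by rewrite dot_iter_tridiag // -ltnS.
Qed.

Lemma opact_basis_change k : (k <= N)%N ->
  opact basis_change (block n b k) = block n c k.
Proof.
by move=> lekN; apply/ffunP => i; rewrite !ffunE basis_changeE ?(block_index_le n_gt0).
Qed.

(** [basis_change] acts componentwise and commutes with the matrix action, so it preserves the
    matrices of the recurrence. *)
Lemma block_recurrence_transfer (A B : nat -> 'M[R[i]]_n) k r : (k <= N)%N ->
  opact (iter r T) (block n b k) =
    (if (k < N)%N then mxact (A k.+1)^H (block n b k.+1) else 0)
    + mxact (B k) (block n b k)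
    + (if (0 < k)%N then mxact (A k) (block n b k.-1) else 0) ->
  opact (iter r S) (block n c k) =
    (if (k < N)%N then mxact (A k.+1)^H (block n c k.+1) else 0)
    + mxact (B k) (block n c k)
    + (if (0 < k)%N then mxact (A k) (block n c k.-1) else 0).
Proof.
move=> lekN /(congr1 (opact basis_change)).
have -> : opact basis_change (opact (iter r T) (block n b k))
    = opact (iter r S) (block n c k).
  by apply/ffunP => i; rewrite !ffunE basis_change_iter ?(block_index_le n_gt0).
move=> ->; rewrite !opactD; congr (_ + _ + _).
- by case: ifP => ltkN; rewrite ?opact0 // opact_mxact opact_basis_change.
- by rewrite opact_mxact opact_basis_change.
- case: ifP => k0; rewrite ?opact0 // opact_mxact opact_basis_change //.
  exact: leq_trans (leq_pred _) _.
Qed.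

End BandOperators.

(** * Krawtchouk coefficients and the matrix weight *)

(** Both K_0 and h_0 equal 1. With the positivity of the weight this makes <0|phi_j> nonzero. *)
Lemma transition_coef0 (R : realType) t (p : R) m j :
  transition_coef t p m 0 j = sqrt_kweight t p m j.
Proof.
rewrite /transition_coef /krawtchouk /sqrt_knorm /knorm /poch.
rewrite big_ord1 !big_ord0 /= fact0 muln0 !expr0 !mul1r divr1 !mulr1.
by rewrite invr1 sqrtr1 divr1 mul1r.
Qed.

(** D(j) is the square of a real diagonal matrix of signed roots, one copy of which goes to each
    side; the signs cancel. *)
Lemma Wmx_factor (R : realType) n t (p : R) m j :
  (forall l : 'I_n, 0 <= kweight p m (n * j + l)%N) ->
  let E := Lmx n t p m j *m block_diag n (sqrt_kweight t p m) j in
  Wmx n t p m j = E *m E^H.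
Proof.
move=> w_ge0 E; rewrite adjmxM block_diag_conj /Wmx /E !mulmxA; congr (_ *m _).
rewrite -mulmxA; congr (_ *m _); apply/matrixP => i l.
rewrite mul_mx_diag !mxE; case: eqVneq => [->|_]; last by rewrite mul0r.
by rewrite !mulr1n -rmorphM /= sqrt_kweightM.
Qed.

Theorem mainTheorem3 (R : realType) (n N : nat) (n_gt0 : (0 < n)%N)
    (V : lmodType R[i]) (ip : {dot V for Num.conj})
    (ket phi : nat -> V) (H Lp Lm : {linear V -> V})
    (a : R) (s t : bool) (A B : nat -> 'M[R[i]]_n) :
  let m := (n * N + n - 1)%N in
  let p := kpar s a in
  let P := Pop a H Lp Lm in
  let e := block n ket in
  let Phi := block n phi in
  let E := fun j : nat => mxip ip (e 0%N) (Phi j) in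
  let alpha := block_diag n (fun j => mu R m j ^+ n) in
  let Lambda := block_diag n (fun k => lam R m k ^+ n) in
  let theta := fun j : nat => E j *m (alpha j)^H *m invmx (E j) in
  sin a != 0 ->
  orthonormal_basis m ip ket ->
  su2_representation m ket H Lp Lm ->
  orthonormal_basis m ip phi ->
  (forall j, (j <= m)%N -> P (phi j) = (mu R m j)%:C *: phi j) ->
  H_tridiagonal m a H phi ->
  (forall k j, (k <= m)%N -> (j <= m)%N ->
     ip (ket k) (phi j) = (transition_coef t p m k j)%:C) ->
  (forall k, (k <= N)%N -> B k = (B k)^H) ->
  (forall k, (k <= N)%N ->
     opact (iter n P) (e k) =
       (if (k < N)%N then mxact (A k.+1)^H (e k.+1) else 0)
       + mxact (B k) (e k)
       + (if (0 < k)%N then mxact (A k) (e k.-1) else 0)) ->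
  (forall j, (j <= N)%N ->
     [/\ Lmx n t p m j \in unitmx,
         E j = Lmx n t p m j *m block_diag n (sqrt_kweight t p m) j &
         E j \in unitmx]) /\
  exists M : nat -> nat -> 'M[R[i]]_n,
    let Pi := mxpoly_eval M in
    [/\ forall k, (k <= N)%N -> M k k \in unitmx,
        forall j, (j <= N)%N ->
          Pi 0%N (theta j) = 1%:M /\
          forall k, (k <= N)%N ->
            Pi k (theta j) *m theta j =
              (if (k < N)%N then (A k.+1)^H *m Pi k.+1 (theta j) else 0)
              + B k *m Pi k (theta j)
              + (if (0 < k)%N then A k *m Pi k.-1 (theta j) else 0),
        forall k l, (k <= N)%N -> (l <= N)%N ->
          \sum_(j < N.+1)
            Pi k (theta j) *m Wmx n t p m j *m (Pi l (theta j))^H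
          = (k == l)%:R%:M &
        forall k j, (k <= N)%N -> (j <= N)%N ->
          Lambda k *m Pi k (theta j) =
            (if (j < N)%N then
               Pi k (theta j.+1) *m E j.+1 *m A j.+1 *m invmx (E j) else 0)
            + Pi k (theta j) *m E j *m B j *m invmx (E j)
            + (if (0 < j)%N then
                 Pi k (theta j.-1) *m E j.-1 *m (A j)^H *m invmx (E j)
               else 0)].
Proof.
move=> m p P e Phi E alpha Lambda theta sina onk su2 onp Pphi Htri ketphi Bherm blockP.
(* These coefficients describe both P on [ket] and H on [phi]. *)
pose u k := (sin a * rho_up R m k)%:C.
pose d k := (cos a * lam R m k)%:C.
pose w k := (sin a * rho_dn R m k)%:C.
pose T : {linear V -> V} := Pop a H Lp Lm.
have Tket k : (k <= m)%N -> T (ket k) = u k *: ket k.+1 + d k *: ket k + w k *: ket k.-1.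
  move=> lekm; have [Hk Lpk Lmk] := su2 k lekm.
  rewrite /T /= /Pop Hk Lpk Lmk scalerDr !scalerA -!rmorphM /=.
  by rewrite addrCA addrA.
have um0 : u m = 0 by rewrite /u /rho_up subrr mulr0 sqrtr0 mulr0.
have u_neq0 k : (k < m)%N -> u k != 0.
  move=> ltkm; rewrite fmorph_eq0 mulf_neq0 // sqrtr_eq0 -ltNge mulr_gt0 //.
  by rewrite subr_gt0 ltr_nat.
have w_gt0 j : (j <= m)%N -> 0 < kweight p m j by apply: kweight_gt0.
have idx_le := block_index_le n_gt0 (N := N).
have E_L j : (j <= N)%N -> E j = Lmx n t p m j *m block_diag n (sqrt_kweight t p m) j.
  move=> lejN; apply/matrixP => i l; rewrite mul_mx_diag !mxE !ffunE muln0.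
  rewrite ketphi ?idx_le // -?rmorphM //.
  by rewrite /m; have := ltn_ord i; nia.
(* The Vandermonde nodes are the eigenvalues mu of P itself, which are distinct; their n-th powers
   in alpha_j may coincide. *)
have uE j : (j <= N)%N -> E j \in unitmx.
  move=> lejN;
  apply: (eigenvector_block_unit n_gt0 um0 Tket (x := fun l : 'I_n => mu R m (n * j + l)%N)).
  - move=> l1 l2 /eqP; rewrite (inj_eq (addIr _)) (inj_eq (mulfI _)) ?pnatr_eq0 //.
    by rewrite eqr_nat eqn_add2l => /eqP/val_inj.
  - move=> l; rewrite ffunE ketphi ?idx_le // transition_coef0 fmorph_eq0.
    have := w_gt0 _ (idx_le j l lejN); rewrite -(sqrt_kweightM t) ?ltW ?w_gt0 ?idx_le //.
    by apply: contraTneq => ->; rewrite mul0r ltxx.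
  - by move=> r v l; rewrite ffunE (dot_iter_eigen onp r v (T := T) Pphi) ?idx_le.
split=> [j lejN|].
  have := uE j lejN; split => //; last exact: E_L.
  by have := uE j lejN; rewrite E_L // unitmx_mul => /andP[].
pose F k j := mxip ip (e k) (Phi j).
have uA k : (0 < k <= N)%N -> A k \in unitmx.
  case: k => // k; rewrite /= => ltkN.
  (* Pairing the block recurrence with e_{k+1} leaves only A_{k+1}^*, which is thus the invertible
     upper block of P^n. *)
  have := upper_block_unit n_gt0 u_neq0 um0 onk Tket ltkN.
  rewrite (blockP k (ltnW ltkN)) ltkN !mxipDl !mxip_actl !(mxip_block_onb n_gt0 onk) ?(ltnW ltkN) //.
  rewrite eqxx mulmx1 (ltn_eqF (ltnSn k)) raddf0 mulmx0 addr0.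
  have -> : mxip ip (if (0 < k)%N then mxact (A k) (e k.-1) else 0) (block n ket k.+1) = 0.
    case: ifP => k0; rewrite ?mxip0l // mxip_actl (mxip_block_onb n_gt0 onk) //.
      by rewrite ltn_eqF ?raddf0 ?mulmx0 // ltnS leq_pred.
    exact: leq_trans (leq_pred k) (ltnW ltkN).
  by rewrite addr0 unitmx_adj.
have Frec k j : (k <= N)%N -> (j <= N)%N -> F k j *m alpha j =
    (if (k < N)%N then (A k.+1)^H *m F k.+1 j else 0) + B k *m F k j
    + (if (0 < k)%N then A k *m F k.-1 j else 0).
  move=> lekN lejN; rewrite -(mxip_block_eigenr n_gt0 ket n k (T := T) onp Pphi lejN).
  rewrite (blockP k lekN) !mxipDl mxip_actl; congr (_ + _ + _).
    by case: ifP; rewrite ?mxip0l ?mxip_actl.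
  by case: ifP; rewrite ?mxip0l ?mxip_actl.
have Hrec k j : (k <= N)%N -> (j <= N)%N -> Lambda k *m F k j =
    (if (j < N)%N then F k j.+1 *m A j.+1 else 0) + F k j *m B j
    + (if (0 < j)%N then F k j.-1 *m (A j)^H else 0).
  move=> lekN lejN.
  have Hket l : (l <= m)%N -> H (ket l) = (lam R m l)%:C *: ket l by move=> /su2[].
  rewrite -(mxip_block_eigenl n_gt0 phi n j onk Hket lekN).
  rewrite (block_recurrence_transfer n_gt0 um0 onk Tket Htri lejN (blockP j lejN)).
  (* Matrices leave the second argument as adjoints: A_{j+1}^* becomes A_{j+1}, A_j becomes A_j^*,
     and B_j is self-adjoint. *)
  rewrite !mxipDr mxip_actr -Bherm //; congr (_ + _ + _).
    by case: ifP; rewrite ?mxip0r // mxip_actr adjmxK.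
  by case: ifP; rewrite ?mxip0r ?mxip_actr.
pose G k j := F k j *m invmx (E j).
have Grec k j : (k <= N)%N -> (j <= N)%N -> G k j *m theta j =
    (if (k < N)%N then (A k.+1)^H *m G k.+1 j else 0) + B k *m G k j
    + (if (0 < k)%N then A k *m G k.-1 j else 0).
  move=> lekN lejN; rewrite /theta /G block_diag_conj !mulmxA mulmxKV ?uE // Frec //.
  by rewrite !mulmxDl; congr (_ + _ + _); case: ifP; rewrite ?mul0mx ?mulmxA.
have PiG k j : (k <= N)%N -> (j <= N)%N ->
    mxpoly_eval (recurrence_coef A B) k (theta j) = G k j.
  elim/ltn_ind: k => -[_ _ lejN|k IHk ltkN lejN].
    by rewrite /mxpoly_eval big_ord1 expr0 mulmx1 /G mulmxV ?uE.
  have uk : A k.+1 \in unitmx by rewrite uA.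
  have := mxpoly_eval_recurrence B (theta j) uk; rewrite /= (IHk k) ?(ltnW ltkN) // Grec ?(ltnW ltkN) // ltkN.
  have -> : (if (0 < k)%N then A k *m mxpoly_eval (recurrence_coef A B) k.-1 (theta j) else 0)
      = if (0 < k)%N then A k *m G k.-1 j else 0.
    case: ifP => // k0; rewrite IHk ?(leq_trans (leq_pred k)) ?(ltnW ltkN) //.
    by rewrite ltnS leq_pred.
  (* Both recurrences now agree except in the term with A_{k+1}^*, which is invertible as k < N. *)
  by move=> /addIr/addIr/(can_inj (mulKmx _)) ->; rewrite ?unitmx_adj.
exists (recurrence_coef A B) => Pi; split.
- move=> k lekN; apply: recurrence_coef_unit => l /andP[l0 lelk].
  by rewrite uA // l0 (leq_trans lelk).
- move=> j lejN; split; first by rewrite /Pi PiG // /G mulmxV ?uE.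
  (* The recurrence is read off from G, which also covers k = N, where the generating recurrence
     would involve the inverse of A_{N+1}^*. *)
  move=> k lekN; rewrite /Pi PiG // Grec //; congr (_ + _ + _).
    by case: ifP => // ltkN; rewrite PiG.
  by case: ifP => // k0; rewrite PiG // (leq_trans (leq_pred k)).
- move=> k l lekN lelN; rewrite -(mxip_block_onb n_gt0 onk) //.
  rewrite (mxip_block_parseval n_gt0 ket ket k l onp); apply: eq_bigr => j _.
  have lejN : (j <= N)%N by rewrite -ltnS.
  rewrite /Pi !PiG // Wmx_factor => [|i]; last by rewrite ltW // w_gt0 // idx_le.
  (* Since W(j) = E_j E_j^*, the factors E_j^{-1} in G cancel and F_k(j) F_l(j)^* remains. *)
  by rewrite -E_L // /G adjmxM adjmx_inv !mulmxA mulmxKV ?uE // mulmxK ?unitmx_adj ?uE.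
(* [Hrec] is multiplied on the right by E_j^{-1}, and F_k at j + 1 and j - 1 is rewritten as
   Pi_k(theta) E at the same index. *)
- move=> k j lekN lejN; rewrite /Pi PiG // /G mulmxA Hrec // !mulmxDl mulmxKV ?uE //.
  congr (_ + _ + _).
    by case: ifP => [ltjN|_]; [rewrite PiG // /G mulmxKV ?uE | rewrite mul0mx].
  case: ifP => [_|_]; last by rewrite mul0mx.
  rewrite PiG ?(leq_trans (leq_pred j)) //.
  by rewrite /G mulmxKV ?uE ?(leq_trans (leq_pred j)).
Qed.
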